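(* Let $q$ be a prime power, let $n,k,t$ be integers with $1\le t\le k\le n$, and let $\mathbb{C}$ be an $[n,2t,k]_q$ code in the Grassmannian $\mathcal{G}_q(n,k)$. Let $$\mathcal{C}=\{\,ch(\beta+X)\;:\;X\in\mathbb{C},\ \beta\in\mathbb{F}_q^n\,\}$$ be the set of characteristic vectors of all cosets of all subspaces in $\mathbb{C}$. Then $\mathcal{C}$ is a $(q^n,\;2q^k-2q^{k-t},\;q^k)$ constant weight code, and it has exactly $q^{n-k}\,|\mathbb{C}|$ codewords.
   Context: $\mathcal{G}_q(n,k)$ is the set of all $k$-dimensional subspaces of $\mathbb{F}_q^n$, with distance $d(U,V)=\dim U+\dim V-2\dim(U\cap V)$. A subset $\mathbb{C}\subseteq\mathcal{G}_q(n,k)$ is an $[n,d,k]_q$ code (constant dimension code) if $d(U,V)\ge d$ for all distinct $U,V\in\mathbb{C}$. For a subset $A\subseteq\mathbb{F}_q^n$, $ch(A)$ denotes its binary characteristic vector of length $q^n$, with coordinates indexed by the elements of $\mathbb{F}_q^n$ (in some fixed order), having a $1$ exactly in the coordinates indexed by elements of $A$. For $\beta\in\mathbb{F}_q^n$, $\beta+X=\{\beta+x: x\in X\}$. An $(N,d,w)$ code is a set of binary words of length $N$, each of Hamming weight $w$, such that any two distinct words are at Hamming distance at least $d$. *)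

(* Defs.v *)
From HB Require Import structures.
From mathcomp Require Import all_boot all_order all_fingroup all_algebra all_field.

Set Implicit Arguments.
Unset Strict Implicit.
Unset Printing Implicit Defensive.

Import GRing.Theory.
Local Open Scope ring_scope.

(* Over a finite field there are finitely many subspaces, as a subspace is
   represented by its canonical matrix; this makes {set {vspace vT}} available.
   VectorInternalTheory holds the subtype structure on {vspace vT}. *)
Import VectorInternalTheory.
HB.instance Definition _ (F : finFieldType) (vT : vectType F) :=
  [Countable of {vspace vT} by <:].
HB.instance Definition _ (F : finFieldType) (vT : vectType F) :=
  [Finite of {vspace vT} by <:].

Section Grassmannian.

Variables (F : finFieldType) (n : nat).
Implicit Types (U V X : {vspace 'rV[F]_n}) (C : {set {vspace 'rV[F]_n}}).

Definition grassmannian (k : nat) : {set {vspace 'rV[F]_n}} :=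
  [set U | \dim U == k].

(* The truncated subtraction on nat is exact, since \dim (U :&: V) is at most
   \dim U and \dim V. *)
Definition subspace_dist U V : nat :=
  (\dim U + \dim V - 2 * \dim (U :&: V))%N.

Definition constant_dimension_code (d k : nat) C : Prop :=
  C \subset grassmannian k /\
  {in C &, forall U V, U != V -> (d <= subspace_dist U V)%N}.

Definition coset_of_vspace (b : 'rV[F]_n) X : {set 'rV[F]_n} :=
  [set b + x | x in X].

(* s is the order in which the vectors index the coordinates: coordinate i
   belongs to the vector s i. *)
Definition ch (N : nat) (s : 'I_N -> 'rV[F]_n) (A : {set 'rV[F]_n}) :
    N.-tuple bool :=
  [tuple s i \in A | i < N].

Definition coset_code (N : nat) (s : 'I_N -> 'rV[F]_n) C :
    {set N.-tuple bool} :=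
  [set ch s (coset_of_vspace b X) | X in C, b in [set: 'rV[F]_n]].

End Grassmannian.

Section BinaryWords.

Variable N : nat.
Implicit Types u v : N.-tuple bool.

Definition hamming_weight u : nat := #|[set i | tnth u i]|.

Definition hamming_dist u v : nat := #|[set i | tnth u i != tnth v i]|.

Definition constant_weight_code (d w : nat) (W : {set N.-tuple bool}) : Prop :=
  {in W, forall u, hamming_weight u = w} /\
  {in W &, forall u v, u != v -> (d <= hamming_dist u v)%N}.

End BinaryWords.

(* Main.v *)
Require Import Defs.
From HB Require Import structures.
From mathcomp Require Import all_boot all_order all_fingroup all_algebra all_field.
From mathcomp Require Import zify.

(** Two cosets meeting in a point [z] are [z + X] and [z + Y], so they share
    the [q ^ \dim (X :&: Y)] points of [z + (X :&: Y)]; the distance of the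
    subspace code bounds this by [q ^ (k - t)]. For the number of codewords,
    every coset of [X] has exactly one representative in a complement of [X]. *)

Set Implicit Arguments.
Unset Strict Implicit.
Unset Printing Implicit Defensive.

Section Cosets.

Import GRing.Theory.
Local Open Scope ring_scope.

Variables (F : finFieldType) (n : nat).
Implicit Types (X Y : {vspace 'rV[F]_n}) (b c z : 'rV[F]_n).

Lemma mem_coset b X z : (z \in coset_of_vspace b X) = (z - b \in X).
Proof.
apply/imsetP/idP => [[x xX ->]|zX]; first by rewrite addrC addKr.
by exists (z - b); rewrite // addrC subrK.
Qed.

Lemma coset_id b X : b \in coset_of_vspace b X.
Proof. by rewrite mem_coset subrr mem0v. Qed.

Lemma coset_transl b X z :
  z \in coset_of_vspace b X -> coset_of_vspace b X = coset_of_vspace z X.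
Proof.
rewrite mem_coset => zX; apply/setP => y; rewrite !mem_coset.
(* Here [y - b] splits as [(y - z) + (z - b)], whose second term lies in [X]. *)
by rewrite -[RHS](rpredDr _ zX) addrA subrK.
Qed.

Lemma card_coset b X : #|coset_of_vspace b X| = (#|F| ^ \dim X)%N.
Proof. by rewrite card_imset; [exact: card_vspace | exact: addrI]. Qed.

Lemma card_cosetI b c X Y z :
  z \in coset_of_vspace b X :&: coset_of_vspace c Y ->
  #|coset_of_vspace b X :&: coset_of_vspace c Y| = (#|F| ^ \dim (X :&: Y))%N.
Proof.
case/setIP => /coset_transl-> /coset_transl->; rewrite -(card_coset z).
by apply: eq_card => y; rewrite !inE !mem_coset memv_cap.
Qed.

(** Both sets can be based at the common point [b]; translating by [-b] then recovers the
    subspace. *)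
Lemma coset_dir_inj b c X Y : coset_of_vspace b X = coset_of_vspace c Y -> X = Y.
Proof.
move=> eqXY; have := coset_id b X; rewrite {1}eqXY => /coset_transl eqY.
rewrite {}eqY in eqXY; apply/vspaceP => x.
by have /setP/(_ (x + b)) := eqXY; rewrite !mem_coset addrK.
Qed.

(** The difference [b - c] lies both in [X] and in its complement, which meet only in 0. *)
Lemma coset_compl_inj X :
  {in (X^C)%VS &, injective (fun b => coset_of_vspace b X)}.
Proof.
move=> b c bX cX eq_bc; have := coset_id b X; rewrite {}eq_bc mem_coset => bcX.
apply/eqP; rewrite -subr_eq0 -memv0 -(capv_compl X) memv_cap bcX /=.
exact: rpredB.
Qed.

(** The representative is the component of [b] in the complement; the discarded component lies in
    [X]. *)
Lemma coset_compl_repr b X :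
  exists2 c, c \in (X^C)%VS & coset_of_vspace b X = coset_of_vspace c X.
Proof.
have /memv_addP[x xX [c cX b_def]] : b \in (X + X^C)%VS.
  by rewrite addv_complf memvf.
exists c => //; apply: coset_transl.
by rewrite mem_coset b_def opprD addrCA subrr addr0 rpredN.
Qed.

End Cosets.

Section Words.

Variables (F : finFieldType) (n N : nat) (s : 'I_N -> 'rV[F]_n).
Hypothesis bij_s : bijective s.
Implicit Types A B : {set 'rV[F]_n}.

(** Since [s] is onto, every vector has a coordinate that records its membership. *)
Lemma ch_inj : injective (ch s).
Proof.
move=> A B eqAB; apply/setP => z; have [s' _ sK] := bij_s.
have := congr1 (fun u => tnth u (s' z)) eqAB.
by rewrite !tnth_mktuple sK.
Qed.

Lemma hamming_weight_ch A : hamming_weight (ch s A) = #|A|.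
Proof.
rewrite -(on_card_preimset (onW_bij A bij_s)).
by apply: eq_card => i; rewrite !inE tnth_mktuple.
Qed.

Lemma hamming_dist_ch A B :
  hamming_dist (ch s A) (ch s B) = #|A| + #|B| - 2 * #|A :&: B|.
Proof.
(* The words differ exactly at the coordinates that [s] sends into the symmetric difference. *)
have -> : hamming_dist (ch s A) (ch s B) = #|(A :\: B) :|: (B :\: A)|.
  rewrite -(on_card_preimset (onW_bij _ bij_s)).
  by apply: eq_card => i; rewrite !inE !tnth_mktuple; do 2!case: (s i \in _).
rewrite cardsU (_ : _ :&: _ = set0) ?cards0 ?subn0; last first.
  by apply/setP => i; rewrite !inE; do 2!case: (i \in _).
have := cardsID B A; have := cardsID A B; rewrite (setIC B A); lia.
Qed.

Lemma card_coset_code k (C : {set {vspace 'rV[F]_n}}) :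
  C \subset grassmannian F n k ->
  #|coset_code s C| = #|F| ^ (n - k) * #|C|.
Proof.
move=> /subsetP dimC.
(* [D] indexes the codewords without repetition: each coset of each subspace is represented once. *)
pose D := [set p : {vspace 'rV[F]_n} * 'rV[F]_n |
            (p.1 \in C) && (p.2 \in (p.1^C)%VS)].
have -> : coset_code s C = [set ch s (coset_of_vspace p.2 p.1) | p in D].
  apply/setP => u; apply/imset2P/imsetP => [[X b XC _ ->]|[[X b] /=]].
    have [c cX ->] := coset_compl_repr b X.
    by exists (X, c); rewrite // inE XC.
  by rewrite inE => /andP[/= XC _] ->; apply: Imset2spec XC (in_setT b) _.
rewrite card_in_imset => [|[X b] [Y c]]; last first.
  rewrite !inE /= => /andP[_ bX] /andP[_ cY] /ch_inj eq_cosets.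
  have eqXY := coset_dir_inj eq_cosets; rewrite -eqXY in cY eq_cosets *.
  by rewrite (coset_compl_inj bX cY eq_cosets).
rewrite -sum1_card (eq_bigl _ _ (in_set _)).
(* The fibre of [D] over [X] is the complement of [X], of dimension [n - k]. *)
rewrite -(pair_big_dep (mem C) (fun X b => b \in (X^C)%VS) (fun _ _ => 1)) /=.
rewrite (eq_bigr (fun=> #|F| ^ (n - k))) => [|X /dimC].
  by rewrite sum_nat_const mulnC.
rewrite inE => /eqP dimX.
by rewrite sum1_card card_vspace dimv_compl dimvf /dim /= dimX mul1n.
Qed.

End Words.

Theorem theorem1 (q : nat) (F : finFieldType) (n k t : nat)
    (s : 'I_(q ^ n) -> 'rV[F]_n) (C : {set {vspace 'rV[F]_n}}) :
  #|F| = q ->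
  1 <= t -> t <= k -> k <= n ->
  bijective s ->
  constant_dimension_code (2 * t) k C ->
  constant_weight_code (2 * q ^ k - 2 * q ^ (k - t)) (q ^ k) (coset_code s C)
  /\ #|coset_code s C| = q ^ (n - k) * #|C|.
Proof.
move=> cardF t_gt0 le_tk _ bij_s [subC distC]; subst q.
have dimC X : X \in C -> \dim X = k by move/(subsetP subC); rewrite inE => /eqP.
split; last exact: card_coset_code.
split=> [u /imset2P[X b /dimC dimX _ ->]|].
  by rewrite hamming_weight_ch // card_coset dimX.
move=> u v /imset2P[X b XC _ ->] /imset2P[Y c YC _ ->] neq_uv.
rewrite hamming_dist_ch // !card_coset !dimC //.
(* Both words have weight [#|F| ^ k], so only the overlap matters. *)
suff : #|coset_of_vspace b X :&: coset_of_vspace c Y| <= #|F| ^ (k - t) by lia.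
have [->|[z zI]] := set_0Vmem (coset_of_vspace b X :&: coset_of_vspace c Y).
  by rewrite cards0.
rewrite (card_cosetI zI) leq_pexp2l //.
  by apply/card_gt0P; exists 0%R.
(* Two cosets of the same subspace through [z] would coincide and give equal words. *)
have neqXY : X != Y.
  apply: contraNneq neq_uv => eqXY; move: zI; rewrite eqXY.
  by case/setIP => /coset_transl-> /coset_transl->.
(* The distance bound reads [2t <= 2k - 2 dim], where [dim] is that of [X :&: Y]; as [t > 0] the
   subtraction is not truncated, so [dim <= k - t]. *)
by have := distC X Y XC YC neqXY; rewrite /subspace_dist (dimC X) ?(dimC Y) //; lia.
Qed.
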